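(* Let $\mathbf{k}$ be a field of arbitrary characteristic. Suppose that $f\in 2^{[m]*}$ is nice and that $K_f=\mathrm{supp}(f)$ is an abstract simplicial complex on vertex set $[m]$. Then, in $2^{[m]*}$, $$\mathcal{M}(f)=\sum_{i=0}^h\sum_{a\in 2^{[m]}} \beta_{i, a}^{\mathbf{k}(K_f)}\,\delta_a,$$ where $h$ denotes the length of the minimal free resolution of $\mathbf{k}(K_f)$ and $\beta_{i,a}^{\mathbf{k}(K_f)}$ are the Betti numbers of $\mathbf{k}(K_f)$ (their residues modulo $2$ are used as coefficients).
   Context: Let $m$ be a positive integer, $[m]=\{1,\dots,m\}$, and $2^{[m]}$ the power set of $[m]$. $2^{[m]*}$ is the $\mathbb{Z}/2\mathbb{Z}$-algebra of all functions $f:2^{[m]}\to\mathbb{Z}/2\mathbb{Z}=\{0,1\}$ with pointwise operations. For $a\in 2^{[m]}$, $\delta_a\in 2^{[m]*}$ is defined by $\delta_a(b)=1\Leftrightarrow b=a$. The support is $\mathrm{supp}(f)=f^{-1}(1)\subseteq 2^{[m]}$. An abstract simplicial complex is a collection of subsets closed under taking subsets (including the empty set); it is on vertex set $[m]$ if the union of its members is $[m]$. $f$ is nice if $\mathrm{supp}(f)$ is an abstract simplicial complex. The $\mathbb{Z}/2\mathbb{Z}$-valued Möbius transform $\mathcal{M}:2^{[m]*}\to 2^{[m]*}$ is $\mathcal{M}(f)(a)=\sum_{b\subseteq a}f(b)$. Let $\mathbf{k}[\mathbf{v}]=\mathbf{k}[v_1,\dots,v_m]$ with its $\mathbb{N}^m$-grading.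 For $a\subseteq[m]$ put $\mathbf{v}^a=\prod_{i\in a}v_i$. The Stanley–Reisner face ring of a complex $K$ on $[m]$ is $\mathbf{k}(K)=\mathbf{k}[\mathbf{v}]/\langle \mathbf{v}^\tau\mid \tau\subseteq[m],\ \tau\notin K\rangle$. It has an $\mathbb{N}^m$-graded minimal free resolution $0\leftarrow \mathbf{k}(K)\leftarrow F_0\leftarrow F_1\leftarrow\cdots\leftarrow F_h\leftarrow 0$ over $\mathbf{k}[\mathbf{v}]$, with $F_i=\bigoplus_{\mathbf{a}\in\mathbb{N}^m}\mathbf{k}[\mathbf{v}](-\mathbf{a})^{\beta_{i,\mathbf{a}}^{\mathbf{k}(K)}}$, where $\mathbf{k}[\mathbf{v}](-\mathbf{a})$ is the free module generated in degree $\mathbf{a}$. For $a\in 2^{[m]}$, the Betti number $\beta_{i,a}^{\mathbf{k}(K)}$ means $\beta_{i,\mathbf{a}}^{\mathbf{k}(K)}$ with $\mathbf{a}\in\{0,1\}^m$ the indicator vector of $a$ (it is known that $\beta_{i,\mathbf{a}}^{\mathbf{k}(K)}=0$ for $\mathbf{a}\notin\{0,1\}^m$). *)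

(* Defs.v *)
From HB Require Import structures.
From mathcomp Require Import all_boot all_order all_algebra.
From mathcomp Require Import generic_quotient ring_quotient.
From mathcomp Require boolp.
From mathcomp Require Export mpoly.

Set Implicit Arguments.
Unset Strict Implicit.
Unset Printing Implicit Defensive.

Import GRing.Theory.
Local Open Scope ring_scope.

(* The regular module 'F_2^o makes functions into an 'F_2-module under *:. *)
Notation pfun m := {ffun {set 'I_m} -> ('F_2)^o}.

Section PowerSetFunctions.
Variable m : nat.

Definition pdelta (a : {set 'I_m}) : pfun m := [ffun b => (b == a)%:R].

Definition psupp (f : pfun m) : {set {set 'I_m}} := [set a | f a == 1].

Definition simplicial_complex (K : {set {set 'I_m}}) : Prop :=
  set0 \in K /\ forall s t : {set 'I_m}, t \subset s -> s \in K -> t \in K.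

Definition on_vertex_set (K : {set {set 'I_m}}) : Prop := cover K = setT.

Definition nice (f : pfun m) : Prop := simplicial_complex (psupp f).

Definition mobius (f : pfun m) : pfun m :=
  [ffun a : {set 'I_m} => \sum_(b : {set 'I_m} | b \subset a) f b].

End PowerSetFunctions.

Section GeneratedIdeal.
Variables (R : comNzRingType) (I : finType) (g : I -> R) (A : {set I}).

Definition gen_ideal : {pred R} :=
  fun p => boolp.asbool (exists c : I -> R, p = \sum_(i in A) c i * g i).

Lemma gen_idealP p :
  reflect (exists c : I -> R, p = \sum_(i in A) c i * g i) (p \in gen_ideal).
Proof. exact: boolp.asboolP. Qed.

Lemma gen_ideal_zmod_closed : zmod_closed gen_ideal.
Proof.
split=> [|p q /gen_idealP[c ->] /gen_idealP[d ->]]; apply/gen_idealP.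
  by exists (fun=> 0); rewrite big1 // => i _; rewrite mul0r.
exists (fun i => c i - d i); rewrite -sumrB.
by apply: eq_bigr => i _; rewrite mulrBl.
Qed.

HB.instance Definition _ :=
  GRing.isZmodClosed.Build R gen_ideal gen_ideal_zmod_closed.

Lemma gen_idealM r p : p \in gen_ideal -> r * p \in gen_ideal.
Proof.
move=> /gen_idealP[c ->]; apply/gen_idealP; exists (fun i => r * c i).
by rewrite mulr_sumr; apply: eq_bigr => i _; rewrite mulrA.
Qed.

(* The generated ideal is not assumed proper, so R/<g_i | i in A> is given here
   as an R-module (the ring structure of ring_quotient needs 1 \notin I). *)
Definition gen_quot : Type := {ideal_quot gen_ideal}.
HB.instance Definition _ := GRing.Zmodule.on gen_quot.

Definition to_quot (p : R) : gen_quot := \pi_({ideal_quot gen_ideal})%qT p.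

Lemma to_quotD : {morph to_quot : p q / p + q}.
Proof. by move=> p q; rewrite /to_quot raddfD. Qed.

Lemma to_quot_surj x : exists p, x = to_quot p.
Proof. by exists (repr x); rewrite /to_quot reprK. Qed.

Lemma to_quot_eq p q : (to_quot p == to_quot q) = (p - q \in gen_ideal).
Proof. by rewrite Quotient.idealrBE. Qed.

Definition quot_scale (r : R) (x : gen_quot) : gen_quot :=
  to_quot (r * repr (x : {ideal_quot gen_ideal})).

Lemma quot_scaleE r p : quot_scale r (to_quot p) = to_quot (r * p).
Proof.
apply/eqP; rewrite to_quot_eq -mulrBr; apply: gen_idealM.
by rewrite -to_quot_eq; apply/eqP; rewrite {1}/to_quot reprK.
Qed.

Lemma quot_scaleA a b x :
  quot_scale a (quot_scale b x) = quot_scale (a * b) x.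
Proof. by case: (to_quot_surj x) => p ->; rewrite !quot_scaleE mulrA. Qed.

Lemma quot_scale1 : left_id 1 quot_scale.
Proof. by move=> x; case: (to_quot_surj x) => p ->; rewrite quot_scaleE mul1r. Qed.

Lemma quot_scaleDr : right_distributive quot_scale +%R.
Proof.
move=> r x y; case: (to_quot_surj x) => p ->; case: (to_quot_surj y) => q ->.
by rewrite -to_quotD !quot_scaleE mulrDr to_quotD.
Qed.

Lemma quot_scaleDl x : {morph quot_scale^~ x : a b / a + b}.
Proof.
move=> a b /=; case: (to_quot_surj x) => p ->.
by rewrite !quot_scaleE mulrDl to_quotD.
Qed.

HB.instance Definition _ := GRing.Zmodule_isLmodule.Build R gen_quot
  quot_scaleA quot_scale1 quot_scaleDr quot_scaleDl.

End GeneratedIdeal.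

Section Resolutions.
Variables (k : fieldType) (m : nat).
Local Notation S := {mpoly k[m]}.

(* p lies in the component of multidegree a of S(-d), the free module on one
   generator of degree d; for d = 0 this is the usual N^m-grading of S. *)
Definition shift_homog (d a : 'X_{1..m}) (p : S) : Prop :=
  forall n, n \in msupp p -> (d + n)%MM = a.

(* F_i is the direct sum of the S(- free_deg i j) over j < free_rank i,
   realized as row vectors; all F_i with i large may be 0. *)
Record free_sequence := FreeSequence {
  free_rank : nat -> nat;
  free_deg : forall i, 'I_(free_rank i) -> 'X_{1..m};
  free_bd : forall i,
    {linear 'rV[S]_(free_rank i.+1) -> 'rV[S]_(free_rank i)}
}.

Definition free_homog (F : free_sequence) i (a : 'X_{1..m})
    (u : 'rV[S]_(free_rank F i)) : Prop :=
  forall j, shift_homog (free_deg (i := i) j) a (u 0 j).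

Definition irrelevant_ideal : {pred S} :=
  gen_ideal (fun i : 'I_m => 'X_i : S) setT.

(* M is an S-module whose component of multidegree a is [set x | G a x]. *)
Record minimal_free_resolution (M : lmodType S) (G : 'X_{1..m} -> M -> Prop)
    (F : free_sequence) (aug : {linear 'rV[S]_(free_rank F 0) -> M}) : Prop := {
  res_aug_graded : forall a u, free_homog a u -> G a (aug u);
  res_bd_graded : forall i a (u : 'rV_(free_rank F i.+1)),
    free_homog a u -> free_homog a (free_bd F i u);
  res_aug_surj : forall x, exists u, aug u = x;
  res_exact0 : forall u, aug u = 0 <-> exists w, free_bd F 0 w = u;
  res_exact : forall i (u : 'rV_(free_rank F i.+1)),
    free_bd F i u = 0 <-> exists w, free_bd F i.+1 w = u;
  res_minimal : forall i (u : 'rV_(free_rank F i.+1)) j,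
    free_bd F i u 0 j \in irrelevant_ideal
}.

Definition has_length (F : free_sequence) (h : nat) : Prop :=
  (0 < free_rank F h)%N /\ forall i, (h < i)%N -> free_rank F i = 0%N.

Definition betti (F : free_sequence) (i : nat) (a : 'X_{1..m}) : nat :=
  #|[set j : 'I_(free_rank F i) | free_deg j == a]|.

End Resolutions.

Section FaceRing.
Variables (k : fieldType) (m : nat) (K : {set {set 'I_m}}).

(* mesym1 t is the indicator vector of t, so 'X_[mesym1 t] is v^t. *)
Definition sqfree_mon (t : {set 'I_m}) : {mpoly k[m]} := 'X_[mesym1 t].

Definition face_ring : Type := gen_quot sqfree_mon (~: K).
HB.instance Definition _ :=
  GRing.Lmodule.copy face_ring (gen_quot sqfree_mon (~: K)).

Definition face_homog (a : 'X_{1..m}) (x : face_ring) : Prop :=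
  exists2 p : {mpoly k[m]}, shift_homog 0%MM a p & x = to_quot sqfree_mon (~: K) p.

End FaceRing.

(* Main.v *)
Require Import Defs.
From HB Require Import structures.
From mathcomp Require Import all_boot all_order all_algebra.

Set Implicit Arguments.
Unset Strict Implicit.
Unset Printing Implicit Defensive.

Import GRing.Theory.
Local Open Scope ring_scope.

(* Modulo 2 the Betti numbers may be counted with signs, so the identity is the
   squarefree part of the computation of the N^m-graded Hilbert series from a
   (not necessarily minimal) resolution F. For a subset a, the component of F in
   degree a is an exact complex of finite-dimensional k-spaces; the monomials
   give a basis of its i-th term indexed by the generators of F_i of degree at
   most a, whose number is the sum of the betti F i b over the subsets b of a.
   This number is r_i + r_(i+1), with r_i the rank of the i-th differential and
   r_0 the dimension of the degree-a part of k(K), which is 1 if a is a face and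
   0 otherwise. Summing over i leaves r_0 modulo 2: f is the Moebius transform of
   the Betti function, and over F_2 that transform is an involution. *)

(** * Degree-[a] strands of linear maps out of graded free modules *)

Section Strand.
Variables (k : fieldType) (m : nat).
Local Notation S := {mpoly k[m]}.

Definition row_homog n (d : 'I_n -> 'X_{1..m}) (a : 'X_{1..m})
    (u : 'rV[S]_n) : Prop :=
  forall j, shift_homog (d j) a (u 0 j).

Section Semilinear.
Variables (M : lmodType S) (r : nat) (q : M -> 'rV[k]_r).
(** Reading a coefficient in a fixed degree does not commute with multiplication by variables, so
    linearity is over constants only. *)
Hypothesis q_lin : forall c x y, q (c%:MP *: x + y) = c *: q x + q y.

Lemma semilinear0 : q 0 = 0.
Proof. by have := q_lin (-1) 0 0; rewrite scaler0 addr0 scaleN1r addNr. Qed.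

Lemma semilinearD x y : q (x + y) = q x + q y.
Proof. by have := q_lin 1 x y; rewrite !scale1r. Qed.

Lemma semilinearZ c x : q (c%:MP *: x) = c *: q x.
Proof. by have := q_lin c x 0; rewrite semilinear0 !addr0. Qed.

End Semilinear.

Lemma semilinear_row_sum n r (q : 'rV[S]_n -> 'rV[k]_r) w :
    (forall c x y, q (c%:MP *: x + y) = c *: q x + q y) ->
  q w = \sum_j \sum_(e <- msupp (w 0 j))
          (w 0 j)@_e *: q ('X_[e] *: delta_mx 0 j).
Proof.
move=> q_lin; have q_sum := big_morph q (semilinearD q_lin) (semilinear0 q_lin).
rewrite {1}(row_sum_delta w) q_sum; apply: eq_bigr => j _.
rewrite {1}[w 0 j]mpolyE scaler_suml q_sum; apply: eq_bigr => e _.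
by rewrite -mul_mpolyC -scalerA semilinearZ.
Qed.

(* [q] reads off the coordinates of the [a]-component of a graded module whose
   degree-[b] component is [G b]. *)
Record component_coord (M : lmodType S) (G : 'X_{1..m} -> M -> Prop)
    (a : 'X_{1..m}) r (q : M -> 'rV[k]_r) : Prop := {
  coord_linear : forall c x y, q (c%:MP *: x + y) = c *: q x + q y;
  coord_neq : forall b x, G b x -> b <> a -> q x = 0;
  coord_inj : forall x, G a x -> q x = 0 -> x = 0
}.

Section Coordinates.
Variables (a : 'X_{1..m}) (n : nat) (d : 'I_n -> 'X_{1..m}).

Definition below : {set 'I_n} := [set j | d j <= a]%MM.

(** Generator [j] contributes to degree [a] the single monomial of exponent [a - d j]; the truncated
    subtraction is exact on [below]. *)
Definition row_coord (w : 'rV[S]_n) : 'rV[k]_#|below| :=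
  \row_j (w 0 (enum_val j))@_(a - d (enum_val j)).

(** The sum has one term if [l] is in [below] and none otherwise, so it extends [u] by zero. *)
Definition row_lift (u : 'rV[k]_#|below|) : 'rV[S]_n :=
  \row_l \sum_(j | enum_val j == l) u 0 j *: 'X_[a - d l].

Lemma row_liftK : cancel row_lift row_coord.
Proof.
move=> u; apply/rowP => j; rewrite !mxE (big_pred1 j) => [|i].
  by rewrite mcoeffZ mcoeffX eqxx mulr1.
by rewrite /= (inj_eq enum_val_inj).
Qed.

Lemma row_lift_homog u : row_homog d a (row_lift u).
Proof.
move=> l e; rewrite mxE => He.
have [j /eqP jl|no_j] := pickP (fun j : 'I_#|below| => enum_val j == l); last first.
  by rewrite big_pred0 // msupp0 in He.
have /[!inE] l_below : l \in below by rewrite -jl enum_valP.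
move: He; rewrite (big_pred1 j) => [/msuppZ_le /mem_msuppXP <-|i].
  by rewrite addmC submK.
by rewrite -jl /= (inj_eq enum_val_inj).
Qed.

Lemma row_coordK w : row_homog d a w -> row_lift (row_coord w) = w.
Proof.
move=> w_homog; apply/rowP => l; rewrite mxE.
have [l_below|l_nbelow] := boolP (l \in below).
  rewrite (big_pred1 (enum_rank_in l_below l)) => [|i].
    rewrite mxE enum_rankK_in //; apply/mpolyP => e.
    rewrite mcoeffZ mcoeffX; have [<-|ne] := eqVneq; first by rewrite mulr1.
    rewrite mulr0; apply/esym/eqP; rewrite mcoeff_eq0.
    by apply: contra ne => /w_homog <-; rewrite addmC addmK.
  by rewrite -{1}(enum_rankK_in l_below l_below) (inj_eq enum_val_inj).
rewrite big_pred0 => [|j]; last first.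
  by apply: contraNF l_nbelow => /eqP <-; exact: enum_valP.
apply/esym/mpolyP => e; rewrite mcoeff0; apply/eqP; rewrite mcoeff_eq0.
apply: contra l_nbelow => /w_homog da.
by rewrite inE -da lem_addr.
Qed.

Lemma row_coordP : component_coord (row_homog d) a row_coord.
Proof.
split=> [c x y|b w w_homog b_neq|w w_homog w0].
- by apply/rowP => j; rewrite !mxE mcoeffD mcoeffCM.
- apply/rowP => j; rewrite !mxE; apply/eqP; rewrite mcoeff_eq0.
  apply/negP => /w_homog db; apply: b_neq; rewrite -db addmC submK //.
  by have := enum_valP j; rewrite inE.
- rewrite -[w]row_coordK // w0; apply/rowP => l.
  by rewrite !mxE big1 // => j _; rewrite mxE scale0r.
Qed.

Lemma row_lift_linear c u v :
  row_lift (c *: u + v) = c%:MP *: row_lift u + row_lift v.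
Proof.
apply/rowP => l; rewrite !mxE mulr_sumr -big_split /=; apply: eq_bigr => j _.
by rewrite !mxE scalerDl mul_mpolyC scalerA.
Qed.

Section Map.
Variables (M : lmodType S) (G : 'X_{1..m} -> M -> Prop) (r : nat).
Variables (q : M -> 'rV[k]_r) (q_coord : component_coord G a q).
Variable T : {linear 'rV[S]_n -> M}.
Hypothesis T_graded : forall b w, row_homog d b w -> G b (T w).

Definition strand_fun (u : 'rV[k]_#|below|) : 'rV[k]_r := q (T (row_lift u)).

Lemma strand_fun_linear : linear strand_fun.
Proof.
move=> c u v.
by rewrite /strand_fun row_lift_linear linearP (coord_linear q_coord).
Qed.

HB.instance Definition _ :=
  GRing.isLinear.Build k 'rV[k]_#|below| 'rV[k]_r _ strand_fun strand_fun_linear.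

Definition strand_mx : 'M[k]_(#|below|, r) := lin1_mx strand_fun.

Lemma mul_strand_mx u : u *m strand_mx = q (T (row_lift u)).
Proof. exact: mul_rV_lin1. Qed.

(* By semilinearity it suffices to treat [w = 'X_[e] *: e_j], which is
   homogeneous. *)
Lemma coord_strand w : q (T w) = row_coord w *m strand_mx.
Proof.
suff mono j e : q (T ('X_[e] *: delta_mx 0 j)) =
    row_coord ('X_[e] *: delta_mx 0 j) *m strand_mx.
  rewrite (semilinear_row_sum (q := fun w => q (T w))) => [|c x y]; last first.
    by rewrite linearP (coord_linear q_coord).
  rewrite [RHS](semilinear_row_sum (q := fun w => row_coord w *m strand_mx)).
    by apply: eq_bigr => j _; apply: eq_bigr => e _; rewrite mono.
  by move=> c x y; rewrite (coord_linear row_coordP) mulmxDl scalemxAl.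
have w_homog : row_homog d (d j + e)%MM ('X_[e] *: delta_mx 0 j).
  move=> l e'; rewrite !mxE eqxx /=; case: eqP => [->|_].
    by rewrite mulr1 => /mem_msuppXP ->.
  by rewrite mulr0 msupp0.
(* In degree [a], lifting the coordinates recovers the vector; in any other degree both sides
   vanish. *)
have [ea|/eqP ne] := eqVneq (d j + e)%MM a.
  by rewrite mul_strand_mx row_coordK -?ea.
rewrite (coord_neq row_coordP w_homog ne) mul0mx.
exact: coord_neq q_coord _ _ (T_graded w_homog) ne.
Qed.

End Map.
End Coordinates.

(** Exactness makes the row space of the strand of [T'] the left kernel of the strand of [T]; then
    rank-nullity applies. *)
Lemma strand_rank a n (d : 'I_n -> 'X_{1..m}) n' (d' : 'I_n' -> 'X_{1..m})
    (M : lmodType S) (G : 'X_{1..m} -> M -> Prop) r (q : M -> 'rV[k]_r)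
    (T : {linear 'rV[S]_n -> M}) (T' : {linear 'rV[S]_n' -> 'rV[S]_n}) :
    component_coord G a q ->
    (forall b w, row_homog d b w -> G b (T w)) ->
    (forall b w, row_homog d' b w -> row_homog d b (T' w)) ->
    (forall u, T u = 0 <-> exists w, T' w = u) ->
  #|below a d| = (\rank (strand_mx a d q T) +
     \rank (strand_mx a d' (row_coord a d) T'))%N.
Proof.
move=> q_coord T_graded T'_graded exT.
have row_coord_d := row_coordP a d.
set B := strand_mx a d q T; set B' := strand_mx a d' _ T'.
suff /eqmxP kerB : (B' == kermx B)%MS.
  by rewrite kerB mxrank_ker subnKC // rank_leq_row.
apply/andP; split; apply/rV_subP => u.
  case/submxP => v ->; apply/sub_kermxP.
  rewrite (mul_strand_mx row_coord_d) -(coord_strand q_coord T_graded).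
  have -> : T (T' (row_lift v)) = 0 by apply/exT; exists (row_lift v).
  exact: semilinear0 (coord_linear q_coord).
move=> /sub_kermxP; rewrite (mul_strand_mx q_coord) => qTu.
have /exT[w T'w] : T (row_lift u) = 0.
  apply: (coord_inj q_coord) qTu; exact/T_graded/row_lift_homog.
(* The preimage [w] may be inhomogeneous; [coord_strand] still computes the coordinates of its
   image. *)
rewrite -[u]row_liftK -T'w (coord_strand row_coord_d T'_graded).
exact: submxMl.
Qed.

End Strand.

(** * Squarefree degrees of the face ring *)

Section FaceRing.
Variables (k : fieldType) (m : nat) (K : {set {set 'I_m}}).
Hypothesis K_complex : simplicial_complex K.
Local Notation quot := (to_quot (@sqfree_mon k m) (~: K)).

Lemma lepm_mesym1 (s t : {set 'I_m}) :
  (mesym1 s <= mesym1 t)%MM = (s \subset t).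
Proof.
apply/mnm_lepP/subsetP => [le_st i i_s|st i].
  by have := le_st i; rewrite !mnmE i_s; case: (i \in t).
by rewrite !mnmE; case: (boolP (i \in s)) => // /st ->.
Qed.

(** If [mesym1 s] occurs in a multiple of the monomial of a nonface [t], then [t] lies in [s] and
    would be a face. *)
Lemma mcoeff_nonface (p : {mpoly k[m]}) (s : {set 'I_m}) :
  s \in K -> p \in gen_ideal (@sqfree_mon k m) (~: K) -> p@_(mesym1 s) = 0.
Proof.
move=> s_K /gen_idealP[c ->]; rewrite raddf_sum big1 //= => t; rewrite inE => t_nK.
apply/eqP; rewrite mcoeff_eq0; apply: contra t_nK.
move/msuppM_le; rewrite /sqfree_mon msuppX => /allpairsP[[e1 e2] /= [_]].
rewrite inE => /eqP -> es; case: K_complex => _; apply; last exact: s_K.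
by rewrite -lepm_mesym1 es lem_addl.
Qed.

(** One column serves faces and nonfaces alike; [face_coord_quot] shows that the choice of
    representative is immaterial. *)
Definition face_coord (s : {set 'I_m}) (x : face_ring k K) : 'rV[k]_1 :=
  \row__ if s \in K then (repr (x : {ideal_quot _}))@_(mesym1 s) else 0.

Lemma face_coord_quot s p :
  face_coord s (quot p) = \row__ if s \in K then p@_(mesym1 s) else 0.
Proof.
apply/rowP => j; rewrite !mxE; case: ifP => // s_K.
apply/eqP; rewrite -subr_eq0 -mcoeffB; apply/eqP; apply: mcoeff_nonface => //.
by rewrite -to_quot_eq; apply/eqP; rewrite {1}/to_quot reprK.
Qed.

Lemma face_coordP s :
  component_coord (@face_homog k m K) (mesym1 s) (face_coord s).
Proof.
split.
- move=> c x y; have [p ->] := to_quot_surj x; have [p' ->] := to_quot_surj y.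
  have -> : c%:MP *: quot p = quot (c%:MP * p) by exact: quot_scaleE.
  rewrite -to_quotD !face_coord_quot; apply/rowP => j; rewrite !mxE.
  by case: ifP => _; rewrite ?mcoeffD ?mcoeffCM // mulr0 addr0.
- move=> b x [p p_homog ->] b_neq; rewrite face_coord_quot.
  apply/rowP => j; rewrite !mxE; case: ifP => // _.
  apply/eqP; rewrite mcoeff_eq0; apply/negP => /p_homog.
  by rewrite add0m => /esym.
- move=> x [p p_homog ->]; rewrite face_coord_quot => /rowP/(_ 0).
  rewrite !mxE => p0; apply/eqP.
  rewrite -[X in _ == X]/(0 : gen_quot _ _).
  have -> : 0 = quot 0 by rewrite /to_quot raddf0.
  rewrite to_quot_eq subr0.
  (* Homogeneity leaves only this monomial: its coefficient is zero if [s] is a face, and otherwise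
     the monomial is in the ideal. *)
  have -> : p = p@_(mesym1 s) *: sqfree_mon k s.
    apply/mpolyP => e; rewrite mcoeffZ mcoeffX.
    have [<-|ne] := eqVneq; first by rewrite mulr1.
    rewrite mulr0; apply/eqP; rewrite mcoeff_eq0; apply: contra ne.
    by move=> /p_homog; rewrite add0m => ->.
  case: ifP p0 => [_ ->|s_nK _]; first by rewrite scale0r rpred0.
  rewrite -mul_mpolyC; apply: gen_idealM; apply/gen_idealP.
  exists (fun t => (t == s)%:R); rewrite (bigD1 s) ?inE ?s_nK //= eqxx mul1r.
  by rewrite big1 ?addr0 // => t /andP[_ /negbTE ->]; rewrite mul0r.
Qed.

(** The single column vanishes for a nonface; for a face, surjectivity reaches the class of the
    monomial of [s], whose coordinate is 1. *)
Lemma rank_face_strand n (d : 'I_n -> 'X_{1..m})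
    (aug : {linear 'rV[{mpoly k[m]}]_n -> face_ring k K}) s :
  (forall b w, row_homog d b w -> face_homog b (aug w)) ->
  (forall x, exists u, aug u = x) ->
  \rank (strand_mx (mesym1 s) d (face_coord s) aug) = (s \in K).
Proof.
move=> aug_graded aug_surj; set B := strand_mx _ _ _ _.
have [s_K|s_nK] := boolP (s \in K); last first.
  apply/eqP; rewrite mxrank_eq0; apply/eqP/row_matrixP => i; rewrite row0 rowE.
  rewrite (mul_strand_mx (face_coordP s)) /face_coord (negbTE s_nK).
  by apply/rowP => j; rewrite !mxE.
apply/eqP; rewrite eqn_leq rank_leq_col lt0n mxrank_eq0; apply/eqP => B0.
have [u aug_u] := aug_surj (quot (sqfree_mon k s)).
have := coord_strand (face_coordP s) aug_graded u.
rewrite -/B B0 mulmx0 aug_u face_coord_quot s_K => /rowP/(_ 0).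
by rewrite !mxE mcoeffX eqxx => /eqP; rewrite oner_eq0.
Qed.

End FaceRing.

(** * Moebius inversion modulo 2 *)

(** Each [g c] is counted once per set between [c] and [a], an even number of times unless
    [c = a]. *)
Lemma mobius_inversion2 (I : finType) (V : nmodType) (g : {set I} -> V)
    (a : {set I}) :
    (forall x : V, x *+ 2 = 0) ->
  \sum_(b : {set I} | b \subset a) \sum_(c : {set I} | c \subset b) g c = g a.
Proof.
move=> V2.
rewrite (exchange_big_dep (fun c : {set I} => c \subset a)) /=; last first.
  by move=> b c ba /subset_trans; exact.
rewrite (bigD1 a) //= [X in _ + X]big1 => [|c /andP[ca c_neq]]; last first.
  (* Removing [c] identifies these sets with the subsets of [a :\: c]. *)
  rewrite (reindex_onto (fun b => c :|: b) (fun b => b :\: c)) /=; last first.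
    by move=> b /andP[_ cb]; rewrite -{1}(setIidPr cb) setID.
  rewrite (eq_bigl (mem (powerset (a :\: c)))) => [|b]; last first.
    rewrite /= powersetE subsetD subUset ca subsetUl andbT /=; congr (_ && _).
    by rewrite setDUl setDv set0U (sameP eqP setDidPl).
  rewrite sumr_const card_powerset.
  have : c \proper a by rewrite properEneq c_neq.
  rewrite properE => /andP[_]; rewrite -setD_eq0 -card_gt0.
  case: #|_| => // n _; by rewrite expnS mulrnA V2 mul0rn.
by rewrite addr0 (big_pred1 a) // => b; rewrite /= eqEsubset.
Qed.

Lemma mulr2_F2 (x : 'F_2) : x *+ 2 = 0.
Proof. by rewrite -mulr_natr [2%:R](_ : _ = 0) ?mulr0 //; exact/eqP. Qed.

Lemma oppr_F2 (x : 'F_2) : - x = x.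
Proof. by apply/eqP; rewrite eq_sym -addr_eq0 -mulr2n mulr2_F2. Qed.

Lemma mobius_involutive m : involutive (@mobius m).
Proof.
move=> f; apply/ffunP => a; rewrite ffunE.
under eq_bigr do rewrite ffunE.
exact: (@mobius_inversion2 _ 'F_2 f a mulr2_F2).
Qed.

(** * Betti numbers and alternating cancellation of ranks *)

(** A degree bounded by the indicator of [a] has entries 0 or 1, hence is the indicator of its own
    support. *)
Lemma sum_betti_below (k : fieldType) m (F : free_sequence k m) i
    (a : {set 'I_m}) :
  (\sum_(b : {set 'I_m} | b \subset a) betti F i (mesym1 b))%N =
  #|below (mesym1 a) (@free_deg _ _ F i)|.
Proof.
pose supp j := [set l | free_deg (f := F) (i := i) j l != 0%N].
rewrite -sum1dep_card (partition_big supp (fun b => b \subset a)) /=.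
  apply: eq_bigr => b ba; rewrite /betti -sum1dep_card; apply: eq_bigl => j.
  apply/eqP/andP => [dj|[]].
    rewrite /supp dj lepm_mesym1 ba; split=> //; apply/eqP/setP => l.
    by rewrite inE mnmE; case: (l \in b).
  move=> /mnm_lepP dj /eqP <-; apply/mnmP => l; rewrite mnmE inE.
  by have := dj l; rewrite mnmE; case: (free_deg j l) (l \in a) => [|[|n]] [].
move=> j /mnm_lepP dj; apply/subsetP => l; rewrite inE.
by have := dj l; rewrite mnmE; case: (free_deg j l) (l \in a) => [|n] [].
Qed.

Theorem theorem1p1 (k : fieldType) (m : nat) (m_gt0 : (0 < m)%N) (f : pfun m)
  (f_nice : nice f) (f_vert : on_vertex_set (psupp f))
  (F : free_sequence k m)
  (aug : {linear 'rV[{mpoly k[m]}]_(free_rank F 0) -> face_ring k (psupp f)})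
  (F_res : minimal_free_resolution (@face_homog k m (psupp f)) aug)
  (h : nat) (F_length : has_length F h) :
  mobius f =
    \sum_(0 <= i < h.+1) \sum_(a : {set 'I_m})
      (betti F i (mesym1 a))%:R *: pdelta a.
Proof.
set g := RHS.
have gE b : g b = \sum_(0 <= i < h.+1) (betti F i (mesym1 b))%:R.
  rewrite /g sum_ffunE; apply: eq_bigr => i _.
  rewrite sum_ffunE (bigD1 b) //= big1 => [|c c_neq]; rewrite !ffunE.
    by rewrite eqxx addr0 /GRing.scale /= mulr1.
  by rewrite eq_sym (negbTE c_neq) scaler0.
(* The involution reduces the goal to [f = mobius g]. *)
rewrite -[RHS]mobius_involutive; congr mobius; apply/ffunP => a.
(* Indices are shifted by one: [rk i.+1] belongs to [free_bd F i], and [rk 0] to the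
   augmentation. *)
pose rk i : nat := if i is i'.+1 then
    \rank (strand_mx (mesym1 a) (@free_deg _ _ F i'.+1)
             (row_coord (mesym1 a) (@free_deg _ _ F i')) (free_bd F i'))
  else nat_of_bool (a \in psupp f).
have card_below i :
    #|below (mesym1 a) (@free_deg _ _ F i)| = (rk i + rk i.+1)%N.
  case: i => [|i].
    rewrite /= -(rank_face_strand f_nice a (res_aug_graded F_res)
                   (res_aug_surj F_res)).
    exact: (strand_rank (face_coordP k f_nice a) (res_aug_graded F_res)
      (@res_bd_graded _ _ _ _ _ _ F_res 0%N) (res_exact0 F_res)).
  exact: (strand_rank (row_coordP k _ _) (@res_bd_graded _ _ _ _ _ _ F_res i)
    (@res_bd_graded _ _ _ _ _ _ F_res i.+1) (@res_exact _ _ _ _ _ _ F_res i)).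
(* The strand of [free_bd F h] has no rows, as the free module in position [h.+1] is zero. *)
have rk_end : rk h.+1 = 0%N.
  apply/eqP; rewrite -leqn0 (leq_trans (rank_leq_row _)) //.
  by rewrite (leq_trans (max_card _)) // card_ord (proj2 F_length).
rewrite ffunE; under eq_bigr do rewrite gE.
rewrite exchange_big /=.
(* Signs are free in ['F_2], so [rk i + rk i.+1] becomes a difference that telescopes. *)
under eq_bigr => i _.
  rewrite -natr_sum sum_betti_below card_below natrD addrC -[X in _ + X]oppr_F2.
  over.
rewrite telescope_sumr // rk_end sub0r oppr_F2 /= inE.
(* An element of ['F_2] is 0 or 1, so [f a] is the truth value of [f a == 1]. *)
by case: (f a) => [[|[|]]] //= ?; apply/val_inj.
Qed.
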